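(* Over $\mathbf{CZF}_0$ plus the axiom of exponentiation, each of the following statements is equivalent to the axiom of power set: (1) There are strongly enough injective sets. (2) Every inhabited set can be strongly embedded into a $\mathcal{P}_1$-complete set. (3) Every singleton set can be strongly embedded into a $\mathcal{P}_1$-complete set. (4) The singleton set $1=\{0\}$ can be strongly embedded into a $\mathcal{P}_1$-complete set. (5) There is a singleton set that can be strongly embedded into a $\mathcal{P}_1$-complete set. (6) There is an inhabited set that can be strongly embedded into a $\mathcal{P}_1$-complete set. (7) There is a $\mathcal{P}_1$-complete set some element of which is a singleton. (8) There is a $\mathcal{P}_1$-complete set some element of which is inhabited.
   Context: $\mathbf{CZF}_0$ is the theory in intuitionistic first-order logic with equality, in the language of set theory ($\in$, $=$), with the axioms: extensionality; pairing; union; replacement (for arbitrary formulas); restricted separation (separation for $\Delta_0$-formulas only, i.e. formulas in which all quantifiers are bounded by sets); strong infinity (there is a least inductive set $\mathbb{N}$); mathematical induction on $\mathbb{N}$ for arbitrary formulas. There is no power set axiom and no excluded middle. All elements of sets are sets; $0=\emptyset$, $1=\{0\}$. The axiom of exponentiation says that for all sets $A,B$ the maps from $A$ to $B$ form a set. The axiom of power set says that for every set $Z$ the class $\mathcal{P}(Z)$ of all subsets of $Z$ is a set. A set is inhabited if it has an element. A set $S$ is a subsingleton if $S\subseteq\{s\}$ for some set $s$. For a set $E$, $\mathcal{P}_1(E)$ is the class of subsets of $E$ that are subsingletons. A set $E$ (of sets) is $\mathcal{P}_1$-complete if $\bigcup S\in E$ for every $S\in\mathcal{P}_1(E)$. An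 injective map $i:U\to V$ of sets is a strong embedding if $i(x)$ is a singleton set for every $x\in U$; one then says $U$ is strongly embedded into $V$. There are strongly enough injective sets if each set is the domain of a strong embedding whose codomain is a $\mathcal{P}_1$-complete set. *)

(* Defs.v *)
From Stdlib Require Import List.

Set Implicit Arguments.

(* Intuitionistic first-order logic with equality, in the language {∈, =}.
   The language has no function symbols, so terms are variables. These are
   de Bruijn indices, and substituting a term for a variable is a renaming. *)

Inductive form : Type :=
| Mem (x y : nat)
| Eq (x y : nat)
| Bot
| And (A B : form)
| Or (A B : form)
| Imp (A B : form)
| All (A : form)
| Ex (A : form).

Declare Scope form_scope.
Delimit Scope form_scope with form.
Bind Scope form_scope with form.

Definition Iff (A B : form) : form := And (Imp A B) (Imp B A).

(* The bound [y] lives outside the binder, the body [A] inside it. *)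
Definition BAll (y : nat) (A : form) : form := All (Imp (Mem 0 (S y)) A).
Definition BEx (y : nat) (A : form) : form := Ex (And (Mem 0 (S y)) A).

Notation "x ∈ y" := (Mem x y) (at level 70, no associativity) : form_scope.
Notation "x ≐ y" := (Eq x y) (at level 70, no associativity) : form_scope.
Notation "⊥" := Bot : form_scope.
Notation "A ∧ B" := (And A B) (at level 80, right associativity) : form_scope.
Notation "A ∨ B" := (Or A B) (at level 85, right associativity) : form_scope.
Notation "A ⇒ B" := (Imp A B) (at level 90, right associativity) : form_scope.
Notation "A ⇔ B" := (Iff A B) (at level 95, no associativity) : form_scope.
Notation "∀ A" := (All A) (at level 100, A at level 100) : form_scope.
Notation "∃ A" := (Ex A) (at level 100, A at level 100) : form_scope.
Notation "∀[ y ] A" := (BAll y A) (at level 100, y at level 69, A at level 100)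
  : form_scope.
Notation "∃[ y ] A" := (BEx y A) (at level 100, y at level 69, A at level 100)
  : form_scope.

Definition scons (t : nat) (f : nat -> nat) (n : nat) : nat :=
  match n with 0 => t | S m => f m end.

Notation "t .: f" := (scons t f) (at level 55, right associativity).

Definition up (f : nat -> nat) : nat -> nat := 0 .: (fun n => S (f n)).

Fixpoint ren (f : nat -> nat) (A : form) : form :=
  match A with
  | Mem x y => Mem (f x) (f y)
  | Eq x y => Eq (f x) (f y)
  | Bot => Bot
  | And A B => And (ren f A) (ren f B)
  | Or A B => Or (ren f A) (ren f B)
  | Imp A B => Imp (ren f A) (ren f B)
  | All A => All (ren (up f) A)
  | Ex A => Ex (ren (up f) A)
  end.

Definition lift : form -> form := ren S.

(* [inst t A] is [A] with [t] for the variable 0; the others move down. *)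
Definition inst (t : nat) : form -> form := ren (t .: (fun n => n)).

(* [prf T G A]: natural deduction of [A] from the open assumptions [G] and the
   nonlogical axioms in [T]. Free variables of an axiom are implicitly
   universally quantified: in the rules with an eigenvariable condition only
   [G] is lifted, so that the universal closure of an axiom is derivable. *)
Inductive prf (T : form -> Prop) : list form -> form -> Prop :=
| prf_ax G A : T A -> prf T G A
| prf_hyp G A : In A G -> prf T G A
| prf_botE G A : prf T G Bot -> prf T G A
| prf_andI G A B : prf T G A -> prf T G B -> prf T G (And A B)
| prf_andE1 G A B : prf T G (And A B) -> prf T G A
| prf_andE2 G A B : prf T G (And A B) -> prf T G B
| prf_orI1 G A B : prf T G A -> prf T G (Or A B)
| prf_orI2 G A B : prf T G B -> prf T G (Or A B)
| prf_orE G A B C :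
    prf T G (Or A B) -> prf T (A :: G) C -> prf T (B :: G) C -> prf T G C
| prf_impI G A B : prf T (A :: G) B -> prf T G (Imp A B)
| prf_impE G A B : prf T G (Imp A B) -> prf T G A -> prf T G B
| prf_allI G A : prf T (map lift G) A -> prf T G (All A)
| prf_allE G A t : prf T G (All A) -> prf T G (inst t A)
| prf_exI G A t : prf T G (inst t A) -> prf T G (Ex A)
| prf_exE G A C :
    prf T G (Ex A) -> prf T (A :: map lift G) (lift C) -> prf T G C
| prf_eqI G t : prf T G (Eq t t)
| prf_eqE G A s t : prf T G (Eq s t) -> prf T G (inst s A) -> prf T G (inst t A).

Definition provable (T : form -> Prop) (A : form) : Prop := prf T nil A.

Inductive delta0 : form -> Prop :=
| delta0_mem x y : delta0 (Mem x y)
| delta0_eq x y : delta0 (Eq x y)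
| delta0_bot : delta0 Bot
| delta0_and A B : delta0 A -> delta0 B -> delta0 (And A B)
| delta0_or A B : delta0 A -> delta0 B -> delta0 (Or A B)
| delta0_imp A B : delta0 A -> delta0 B -> delta0 (Imp A B)
| delta0_all y A : delta0 A -> delta0 (BAll y A)
| delta0_ex y A : delta0 A -> delta0 (BEx y A).

(* The arguments of the following abbreviations are variables of the ambient
   context, hence appear shifted by [n] under [n] binders. *)

Local Open Scope form_scope.

(* There is exactly one value of the variable 0 for which [A]. *)
Definition ExUnique (A : form) : form :=
  ∃ (A ∧ ∀ (ren (0 .: (fun n => 2 + n)) A ⇒ 0 ≐ 1)).

Definition subset (x y : nat) : form := ∀[x] 0 ∈ 1 + y.

Definition is_empty (x : nat) : form := ∀ (0 ∈ 1 + x ⇒ ⊥).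

Definition inhabited (x : nat) : form := ∃ 0 ∈ 1 + x.

(* z = {x} *)
Definition is_single (z x : nat) : form := ∀ (0 ∈ 1 + z ⇔ 0 ≐ 1 + x).

(* z = {x, y} *)
Definition is_upair (z x y : nat) : form :=
  ∀ (0 ∈ 1 + z ⇔ 0 ≐ 1 + x ∨ 0 ≐ 1 + y).

(* p = (x, y) = {{x}, {x, y}} *)
Definition is_pair (p x y : nat) : form :=
  ∀ (0 ∈ 1 + p ⇔ is_single 0 (1 + x) ∨ is_upair 0 (1 + x) (1 + y)).

(* (x, y) ∈ f *)
Definition maps_to (f x y : nat) : form := ∃[f] is_pair 0 (1 + x) (1 + y).

(* u = ⋃ s *)
Definition is_union (u s : nat) : form := ∀ (0 ∈ 1 + u ⇔ ∃[1 + s] 1 ∈ 0).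

(* y = x ∪ {x} *)
Definition is_succ (y x : nat) : form := ∀ (0 ∈ 1 + y ⇔ 0 ∈ 1 + x ∨ 0 ≐ 1 + x).

Definition inductive_set (a : nat) : form :=
  (∃[a] is_empty 0) ∧ ∀[a] ∃[1 + a] is_succ 0 1.

Definition is_N (n : nat) : form :=
  inductive_set n ∧ ∀ (inductive_set 0 ⇒ subset (1 + n) 0).

(* f is a map from a to b, identified with its graph *)
Definition is_map (f a b : nat) : form :=
  (∀[f] ∃[1 + a] ∃[2 + b] is_pair 2 1 0) ∧ ∀[a] ExUnique (maps_to (2 + f) 1 0).

Definition injective_map (f : nat) : form :=
  ∀ ∀ ∀ (maps_to (3 + f) 2 0 ∧ maps_to (3 + f) 1 0 ⇒ 2 ≐ 1).

Definition singleton (x : nat) : form := ∃ is_single (1 + x) 0.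

(* x = 1 = {0} *)
Definition is_one (x : nat) : form := ∃ (is_empty 0 ∧ is_single (1 + x) 0).

(* s ⊆ {t} for some t *)
Definition subsingleton (s : nat) : form := ∃ ∀[1 + s] 0 ≐ 1.

Definition P1_complete (e : nat) : form :=
  ∀ (subset 0 (1 + e) ∧ subsingleton 0 ⇒ ∃[1 + e] is_union 0 1).

Definition strong_embedding (i u v : nat) : form :=
  is_map i u v ∧ injective_map i ∧
  ∀[u] ∀ (maps_to (2 + i) 1 0 ⇒ singleton 0).

Definition strongly_embedded (u v : nat) : form :=
  ∃ strong_embedding 0 (1 + u) (1 + v).

Definition embeds_in_P1_complete (u : nat) : form :=
  ∃ (P1_complete 0 ∧ strongly_embedded (1 + u) 0).

Definition extensionality : form := ∀ ∀ ((∀ (0 ∈ 1 ⇔ 0 ∈ 2)) ⇒ 0 ≐ 1).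

Definition pairing : form := ∀ ∀ ∃ is_upair 0 1 2.

Definition union : form := ∀ ∃ is_union 0 1.

(* In [A], the variable 1 is the argument, 0 the value, and 2 + n the
   parameter n: if every x ∈ a has exactly one y with A(x, y), then
   {y | ∃ x ∈ a, A(x, y)} is a set. *)
Definition replacement (A : form) (a : nat) : form :=
  (∀[a] ExUnique A) ⇒
  ∃ ∀ (0 ∈ 1 ⇔ ∃[2 + a] ren (1 .: 0 .: (fun n => 3 + n)) A).

(* In [A], the variable 0 is the element and 1 + n the parameter n. *)
Definition separation (A : form) (a : nat) : form :=
  ∃ ∀ (0 ∈ 1 ⇔ 0 ∈ 2 + a ∧ ren (0 .: (fun n => 2 + n)) A).

Definition strong_infinity : form := ∃ is_N 0.

(* In [A], the variable 0 is the natural number and 1 + n the parameter n. *)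
Definition induction (A : form) : form :=
  ∀ (is_N 0 ⇒
     (∀ (is_empty 0 ⇒ ren (0 .: (fun n => 2 + n)) A)) ⇒
     (∀[0] (ren (0 .: (fun n => 2 + n)) A ⇒
            ∀ (is_succ 0 1 ⇒ ren (0 .: (fun n => 3 + n)) A))) ⇒
     ∀[0] ren (0 .: (fun n => 2 + n)) A).

Definition exponentiation : form := ∀ ∀ ∃ ∀ (0 ∈ 1 ⇔ is_map 0 3 2).

Definition power_set : form := ∀ ∃ ∀ (0 ∈ 1 ⇔ subset 0 2).

Inductive CZF0 : form -> Prop :=
| CZF0_extensionality : CZF0 extensionality
| CZF0_pairing : CZF0 pairing
| CZF0_union : CZF0 union
| CZF0_replacement A a : CZF0 (replacement A a)
| CZF0_separation A a : delta0 A -> CZF0 (separation A a)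
| CZF0_infinity : CZF0 strong_infinity
| CZF0_induction A : CZF0 (induction A).

Definition CZF0_exp (A : form) : Prop := CZF0 A \/ A = exponentiation.

Definition strongly_enough_injectives : form := ∀ embeds_in_P1_complete 0.

Definition every_inhabited_embeds : form :=
  ∀ (inhabited 0 ⇒ embeds_in_P1_complete 0).

Definition every_singleton_embeds : form :=
  ∀ (singleton 0 ⇒ embeds_in_P1_complete 0).

Definition one_embeds : form := ∃ (is_one 0 ∧ embeds_in_P1_complete 0).

Definition some_singleton_embeds : form :=
  ∃ (singleton 0 ∧ embeds_in_P1_complete 0).

Definition some_inhabited_embeds : form :=
  ∃ (inhabited 0 ∧ embeds_in_P1_complete 0).

Definition P1_complete_with_singleton : form :=
  ∃ (P1_complete 0 ∧ ∃[0] singleton 0).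

Definition P1_complete_with_inhabited : form :=
  ∃ (P1_complete 0 ∧ ∃[0] inhabited 0).

(* Main.v *)
From Stdlib Require Import List PeanoNat Lia.
Require Import Defs.

(* The statements are proved in the cycle
     power set => (1) => (2) => (3) => (4) => (5) => (6) => (7) => (8) => power set.
   Given power sets, x |-> {x} strongly embeds U into P(U), which is closed
   under all unions. Conversely, let a ∈ c ∈ E with E P_1-complete. For any
   proposition φ the union of {x ∈ {c} | φ} lies in E and has a as an element
   iff φ holds; hence every subset of {a} is of the form {x ∈ y | x = a} with
   y ∈ E, so P({a}) is a set by replacement. Exponentiation then makes P({a})^Z
   a set, and P(Z) is its image under f |-> {w ∈ Z | a ∈ f(w)}.

   Derivations are built with rules whose premises for ∀ and ∃ range over all
   variables [x : nat] at the meta level ([all_intro], [ex_elim]), which removes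
   eigenvariable conditions. *)

Set Implicit Arguments.
Unset Strict Implicit.
Local Open Scope form_scope.

(** * Renaming of variables *)

Lemma ren_ext (A : form) (f g : nat -> nat) :
  (forall n, f n = g n) -> ren f A = ren g A.
Proof.
  revert f g; induction A; intros f g H; cbn; rewrite ?H; f_equal; auto;
    apply IHA; intros [|n]; cbn; rewrite ?H; reflexivity.
Qed.

Lemma ren_ren (A : form) (f g : nat -> nat) :
  ren g (ren f A) = ren (fun n => g (f n)) A.
Proof.
  revert f g; induction A; intros f g; cbn; rewrite ?IHA1, ?IHA2; auto;
    rewrite IHA; f_equal; apply ren_ext; intros [|n]; reflexivity.
Qed.

Lemma ren_id (A : form) (f : nat -> nat) : (forall n, f n = n) -> ren f A = A.
Proof.
  revert f; induction A; intros f H; cbn; rewrite ?H; f_equal; auto;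
    apply IHA; intros [|n]; cbn; rewrite ?H; reflexivity.
Qed.

Lemma ren_inst (f : nat -> nat) (t : nat) (A : form) :
  ren f (inst t A) = inst (f t) (ren (up f) A).
Proof.
  unfold inst; rewrite !ren_ren; apply ren_ext; intros [|n]; reflexivity.
Qed.

Lemma ren_up_lift (f : nat -> nat) (A : form) :
  ren (up f) (lift A) = lift (ren f A).
Proof. unfold lift; rewrite !ren_ren; reflexivity. Qed.

Lemma map_ren_up_lift (f : nat -> nat) (G : list form) :
  map (ren (up f)) (map lift G) = map lift (map (ren f) G).
Proof. rewrite !map_map; apply map_ext, ren_up_lift. Qed.

(** A formula has finitely many free variables, which is what later provides a fresh one. A bound
    for the body also serves for the quantified formula. *)
Lemma ren_bound (A : form) : exists N, forall f g,
  (forall n, n < N -> f n = g n) -> ren f A = ren g A.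
Proof.
  induction A as [x y|x y| |A [N HA] B [M HB]|A [N HA] B [M HB]
                 |A [N HA] B [M HB]|A [N HA]|A [N HA]].
  1, 2: exists (S (Nat.max x y)); intros f g H; cbn; f_equal; apply H; lia.
  1: exists 0; reflexivity.
  1, 2, 3: exists (Nat.max N M); intros f g H; cbn; f_equal;
    [apply HA | apply HB]; intros; apply H; lia.
  all: exists N; intros f g H; cbn; f_equal; apply HA; intros [|n] Hn; cbn;
    rewrite ?H; auto with arith.
Qed.

Lemma map_ren_bound (G : list form) : exists N, forall f g,
  (forall n, n < N -> f n = g n) -> map (ren f) G = map (ren g) G.
Proof.
  induction G as [|A G [N HG]].
  - exists 0; reflexivity.
  - destruct (ren_bound A) as [M HA]; exists (Nat.max N M); intros f g H; cbn.
    rewrite (HA f g), (HG f g); auto; intros; apply H; lia.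
Qed.

Lemma delta0_ren (A : form) (f : nat -> nat) : delta0 A -> delta0 (ren f A).
Proof.
  intros H; revert f; induction H; intros f; cbn; constructor; auto.
Qed.

(* A(x, y), where the variable 1 of [A] is the argument and 0 the value *)
Definition app2 (A : form) (x y : nat) : form := ren (y .: x .: (fun n => n)) A.

Ltac ren_eq :=
  unfold app2, inst, replacement, separation, induction, ExUnique, BAll, BEx, Iff;
  cbn; rewrite ?ren_ren;
  repeat first [reflexivity | apply ren_ext; intros [|[|?]]; reflexivity | f_equal].

(** The instances of the schemes carry parameters as free variables. Renaming such an instance gives
    the instance of the same scheme for a renamed formula; the closed axioms are fixed. *)
Lemma CZF0_exp_ren (A : form) (f : nat -> nat) : CZF0_exp A -> CZF0_exp (ren f A).
Proof.
  intros [H| ->]; [left | right; reflexivity].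
  destruct H as [| | |A a|A a HA| |A]; try (constructor; fail).
  - replace (ren f (replacement A a))
      with (replacement (ren (up (up f)) A) (f a)) by ren_eq.
    constructor.
  - replace (ren f (separation A a)) with (separation (ren (up f) A) (f a)) by ren_eq.
    constructor; apply delta0_ren, HA.
  - replace (ren f (induction A)) with (induction (ren (up f) A)) by ren_eq.
    constructor.
Qed.

(** * Structural rules and quantifier rules without eigenvariables *)

Notation "G ⊢ A" := (prf CZF0_exp G A) (at level 72, A at level 71).

Lemma weaken (G G' : list form) (A : form) : G ⊢ A -> incl G G' -> G' ⊢ A.
Proof.
  intros H; revert G'; induction H; intros G' HG;
    assert (Hc : forall D, incl (D :: G) (D :: G'))
      by (intros D; apply incl_cons; auto using in_eq, incl_tl);
    assert (Hm := incl_map lift HG);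
    eauto 4 using prf.
  - apply prf_orE with A B; auto.
  - apply prf_exE with A; [|apply IHprf2, incl_cons; auto using in_eq, incl_tl]; auto.
Qed.

Lemma weaken1 (B : form) (G : list form) (A : form) : G ⊢ A -> B :: G ⊢ A.
Proof. intros H; apply (weaken H), incl_tl, incl_refl. Qed.

(** This makes fresh variables interchangeable: [all_intro] uses it to turn a fresh variable into 0,
    and [ex_elim] to shift a derivation under a binder. *)
Lemma rename (f : nat -> nat) (G : list form) (A : form) :
  G ⊢ A -> map (ren f) G ⊢ ren f A.
Proof.
  intros H; revert f; induction H; intros f; rewrite ?ren_inst; cbn [ren map] in *;
    try (eauto 3 using prf; fail).
  - apply prf_ax, CZF0_exp_ren, H.
  - apply prf_hyp, in_map, H.
  - apply prf_allI; rewrite <- map_ren_up_lift; apply IHprf.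
  - apply prf_exI with (f t); rewrite <- ren_inst; apply IHprf.
  - apply prf_exE with (ren (up f) A); auto.
    rewrite <- map_ren_up_lift, <- ren_up_lift; apply IHprf2.
  - apply prf_eqE with (f s); [apply (IHprf1 f)|rewrite <- ren_inst; apply IHprf2].
Qed.

(* The premise is used at a fresh variable only, which is then renamed to 0. *)
Lemma all_intro (G : list form) (A : form) :
  (forall x, G ⊢ inst x A) -> G ⊢ All A.
Proof.
  intros H.
  destruct (map_ren_bound G) as [N HG], (ren_bound A) as [M HA].
  set (x := Nat.max N M).
  set (f := fun n => if n =? x then 0 else S n).
  assert (Hf : forall n, n < x -> f n = S n).
  { intros n Hn; unfold f; destruct (Nat.eqb_spec n x); auto; lia. }
  apply prf_allI.
  replace (map lift G) with (map (ren f) G).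
  2:{ apply HG; intros n Hn; apply Hf; unfold x; lia. }
  replace A with (ren f (inst x A)); [apply rename, H|].
  (* Writing [A] as its renaming along the identity makes both sides renamings of [A], so that [HA]
     applies. *)
  unfold inst; rewrite ren_ren, <- (@ren_id A (fun n => n)) by reflexivity.
  rewrite ren_ren.
  apply HA; intros [|n] Hn; cbn.
  - unfold f; rewrite Nat.eqb_refl; reflexivity.
  - apply Hf; unfold x; lia.
Qed.

Lemma imp_intro (G : list form) (A B : form) : A :: G ⊢ B -> G ⊢ (A ⇒ B).
Proof. apply prf_impI. Qed.

(** The family of premises is packed by [all_intro] into the single formula [∀ (A ⇒ lift C)], which
    is then instantiated at the eigenvariable 0 of [prf_exE]. *)
Lemma ex_elim (G : list form) (A C : form) :
  G ⊢ Ex A -> (forall x, inst x A :: G ⊢ C) -> G ⊢ C.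
Proof.
  intros H HC.
  assert (HI : G ⊢ All (A ⇒ lift C)).
  { apply all_intro; intros x; cbn; apply prf_impI.
    change (inst x A :: G ⊢ inst x (lift C)); unfold inst, lift.
    rewrite ren_ren, (@ren_id C) by reflexivity; apply HC. }
  apply prf_exE with A; [exact H|].
  apply prf_impE with A; [|apply prf_hyp, in_eq].
  replace (A ⇒ lift C) with (inst 0 (ren (up S) (A ⇒ lift C))).
  - apply prf_allE, weaken1.
    apply (rename S) in HI; exact HI.
  - unfold inst; rewrite ren_ren; apply ren_id; intros [|n]; reflexivity.
Qed.

(** * Tactics and derived rules *)

Section ren_defs.
Variable f : nat -> nat.
Implicit Types (A B : form).

(** As rewrite rules, these let [fsimp] push a renaming inwards while the abbreviations stay
    folded. *)
Lemma ren_Iff A B : ren f (A ⇔ B) = (ren f A ⇔ ren f B).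
Proof. reflexivity. Qed.
Lemma ren_BEx y A : ren f (∃[y] A) = ∃[f y] ren (up f) A.
Proof. reflexivity. Qed.
Lemma ren_is_single z x : ren f (is_single z x) = is_single (f z) (f x).
Proof. reflexivity. Qed.
Lemma ren_is_upair z x y : ren f (is_upair z x y) = is_upair (f z) (f x) (f y).
Proof. reflexivity. Qed.
Lemma ren_is_pair z x y : ren f (is_pair z x y) = is_pair (f z) (f x) (f y).
Proof. reflexivity. Qed.
Lemma ren_maps_to z x y : ren f (maps_to z x y) = maps_to (f z) (f x) (f y).
Proof. reflexivity. Qed.
End ren_defs.

#[local] Hint Rewrite ren_Iff ren_BEx ren_is_single ren_is_upair ren_is_pair
  ren_maps_to : ren.

Ltac fsimp :=
  unfold inst, lift;
  repeat progress (autorewrite with ren; cbn [ren scons up Nat.add]).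
Ltac fsimp_in H :=
  unfold inst, lift in H;
  repeat progress (autorewrite with ren in H; cbn [ren scons up Nat.add] in H).

Lemma hyp (G : list form) (A : form) : A :: G ⊢ A.
Proof. apply prf_hyp, in_eq. Qed.

Lemma all_elim (G : list form) (A : form) : G ⊢ All A -> forall t, G ⊢ inst t A.
Proof. intros H t; apply prf_allE, H. Qed.

Lemma imp_elim (G : list form) (A B : form) : G ⊢ (A ⇒ B) -> G ⊢ A -> G ⊢ B.
Proof. apply prf_impE. Qed.

(** Moves the connective to the meta level, where [destruct] and [rewrite] can act on it. *)
Lemma and_iff (G : list form) (A B : form) : G ⊢ (A ∧ B) <-> G ⊢ A /\ G ⊢ B.
Proof.
  split; [intros H; split; [apply prf_andE1 with B|apply prf_andE2 with A]; exact H|].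
  intros [HA HB]; apply prf_andI; assumption.
Qed.

Lemma iff_elim (G : list form) (A B : form) : G ⊢ (A ⇔ B) -> (G ⊢ A <-> G ⊢ B).
Proof. intros H; apply and_iff in H; split; apply imp_elim, H. Qed.

Lemma or_elim (G : list form) (A B C : form) :
  G ⊢ (A ∨ B) -> A :: G ⊢ C -> B :: G ⊢ C -> G ⊢ C.
Proof. apply prf_orE. Qed.

Lemma ball_elim (G : list form) (y : nat) (A : form) :
  G ⊢ (∀[y] A) -> forall x, G ⊢ (x ∈ y) -> G ⊢ inst x A.
Proof. intros H x; apply (imp_elim (all_elim H x)). Qed.

Lemma bex_intro (G : list form) (y : nat) (A : form) (x : nat) :
  G ⊢ (x ∈ y) -> G ⊢ inst x A -> G ⊢ (∃[y] A).
Proof. intros H HA; apply prf_exI with x, prf_andI; assumption. Qed.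

Ltac fhead :=
  match goal with |- prf ?T ?G ?A => let B := eval hnf in A in change (prf T G B) end.

(* Turns the goal [A :: G ⊢ C] into [G ⊢ C] for a new [G] with [H : G ⊢ A]. *)
Ltac fpush H :=
  match goal with |- prf ?T (?A :: ?G) _ =>
    pose proof (hyp G A) as H;
    repeat match goal with
    | K : prf T G _ |- _ => apply (weaken1 A) in K
    end;
    let G' := fresh "G" in
    set (G' := A :: G) in *; clearbody G'; clear G; rename G' into G
  end.

Ltac fintro H :=
  fhead;
  lazymatch goal with
  | |- prf _ _ (All _) => apply all_intro; intros H; fsimp
  | |- prf _ _ (Imp _ _) => apply imp_intro; fpush H
  end.
Tactic Notation "fintros" ident(a) := fintro a.
Tactic Notation "fintros" ident(a) ident(b) := fintro a; fintro b.
Tactic Notation "fintros" ident(a) ident(b) ident(c) := fintro a; fintro b; fintro c.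
Tactic Notation "fintros" ident(a) ident(b) ident(c) ident(d) :=
  fintro a; fintro b; fintro c; fintro d.

Tactic Notation "fobtain" ident(x) ident(H) "from" constr(K) :=
  apply (ex_elim K); intros x; fsimp; fpush H.
Tactic Notation "fobtain" ident(x) ident(H1) ident(H2) "from" constr(K) :=
  apply (ex_elim K); intros x; fsimp; fpush H1;
  apply and_iff in H1; destruct H1 as [H1 H2].

Tactic Notation "felim_or" constr(K) "as" ident(H) :=
  apply (or_elim K); fpush H.

Tactic Notation "fexists" constr(x) := fhead; apply prf_exI with x; fsimp.

Lemma eq_sym (G : list form) (x y : nat) : G ⊢ (x ≐ y) -> G ⊢ (y ≐ x).
Proof. intros H; apply (@prf_eqE _ _ (0 ≐ S x) _ _ H), prf_eqI. Qed.

(* Replaces [t] by [s] in the goal, given [H : G ⊢ s ≐ t]. *)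
Ltac frw H :=
  lazymatch type of H with prf _ _ (Eq ?s ?t) =>
    let sh v := lazymatch v with t => constr:(0) | _ => constr:(S v) end in
    lazymatch goal with
    | |- prf _ _ (?h ?a ?b ?c) =>
      let a' := sh a in let b' := sh b in let c' := sh c in
      apply (@prf_eqE _ _ (h a' b' c') _ _ H)
    | |- prf _ _ (?h ?a ?b) =>
      let a' := sh a in let b' := sh b in
      apply (@prf_eqE _ _ (h a' b') _ _ H)
    | |- prf _ _ (?h ?a) =>
      let a' := sh a in apply (@prf_eqE _ _ (h a') _ _ H)
    end;
    fsimp
  end.
Ltac frwl H := frw (eq_sym H).

Lemma eq_trans (G : list form) (x y z : nat) :
  G ⊢ (x ≐ y) -> G ⊢ (y ≐ z) -> G ⊢ (x ≐ z).
Proof. intros H K; frw K; exact H. Qed.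

Lemma iff_intro (G : list form) (A B : form) :
  A :: G ⊢ B -> B :: G ⊢ A -> G ⊢ (A ⇔ B).
Proof. intros; apply prf_andI; apply imp_intro; assumption. Qed.

Ltac fiff H := apply iff_intro; fpush H.

Lemma set_ext (G : list form) (a b : nat) :
  (forall x, (x ∈ a) :: G ⊢ (x ∈ b)) -> (forall x, (x ∈ b) :: G ⊢ (x ∈ a)) ->
  G ⊢ (a ≐ b).
Proof.
  intros H K.
  assert (E : G ⊢ extensionality) by (apply prf_ax; left; constructor).
  apply (imp_elim (all_elim (all_elim E b) a)).
  apply all_intro; intros x; apply iff_intro; [apply H|apply K].
Qed.

(** * Pairs and unions *)

(** Descriptions of a set by its elements, such as [is_single], [is_upair], [is_pair] and the
    comprehension formulas below, have this shape up to conversion; their uniqueness claims all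
    reduce to this lemma. *)
Lemma ext_unique (G : list form) (a b : nat) (A : form) :
  G ⊢ (∀ (0 ∈ 1 + a ⇔ A)) -> G ⊢ (∀ (0 ∈ 1 + b ⇔ A)) -> G ⊢ (a ≐ b).
Proof.
  intros Ha Hb; apply set_ext; intros x; fpush H.
  - apply (iff_elim (all_elim Hb x)), (iff_elim (all_elim Ha x)), H.
  - apply (iff_elim (all_elim Ha x)), (iff_elim (all_elim Hb x)), H.
Qed.

Lemma single_iff (G : list form) (z x y : nat) :
  G ⊢ is_single z x -> (G ⊢ (y ∈ z) <-> G ⊢ (y ≐ x)).
Proof. intros H; exact (iff_elim (all_elim H y)). Qed.

Lemma upair_iff (G : list form) (z x w y : nat) :
  G ⊢ is_upair z x w -> (G ⊢ (y ∈ z) <-> G ⊢ (y ≐ x ∨ y ≐ w)).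
Proof. intros H; exact (iff_elim (all_elim H y)). Qed.

Lemma pair_iff (G : list form) (p x y w : nat) :
  G ⊢ is_pair p x y -> (G ⊢ (w ∈ p) <-> G ⊢ (is_single w x ∨ is_upair w x y)).
Proof. intros H; exact (iff_elim (all_elim H w)). Qed.

Lemma union_iff (G : list form) (u s x : nat) :
  G ⊢ is_union u s -> (G ⊢ (x ∈ u) <-> G ⊢ (∃[s] 1 + x ∈ 0)).
Proof. intros H; exact (iff_elim (all_elim H x)). Qed.

Lemma upair_exists (G : list form) (x y : nat) : G ⊢ (∃ is_upair 0 (1 + x) (1 + y)).
Proof.
  assert (E : G ⊢ pairing) by (apply prf_ax; left; constructor).
  (* The outer quantifier of [pairing] stands for the second element, hence [y] comes first. *)
  exact (all_elim (all_elim E y) x).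
Qed.

Lemma single_exists (G : list form) (x : nat) : G ⊢ (∃ is_single 0 (1 + x)).
Proof.
  fobtain z Hz from (upair_exists G x x).
  fexists z. fintros y. fiff H.
  - apply (upair_iff _ Hz) in H. felim_or H as K; exact K.
  - apply (upair_iff _ Hz), prf_orI1, H.
Qed.

Lemma pair_exists (G : list form) (x y : nat) : G ⊢ (∃ is_pair 0 (1 + x) (1 + y)).
Proof.
  fobtain s Hs from (single_exists G x).
  fobtain d Hd from (upair_exists G x y).
  fobtain p Hp from (upair_exists G s d).
  fexists p. fintros w. fiff H.
  - apply (upair_iff _ Hp) in H. felim_or H as K.
    + apply prf_orI1. frwl K. exact Hs.
    + apply prf_orI2. frwl K. exact Hd.
  - apply (upair_iff _ Hp). felim_or H as K.
    + apply prf_orI1, (ext_unique K Hs).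
    + apply prf_orI2, (ext_unique K Hd).
Qed.

Lemma union_exists (G : list form) (s : nat) : G ⊢ (∃ is_union 0 (1 + s)).
Proof.
  assert (E : G ⊢ union) by (apply prf_ax; left; constructor).
  exact (all_elim E s).
Qed.

(** All case distinctions come from the disjunctions in [is_pair] and [is_upair]. The set {x} is {u}
    or {u, v}, so u ∈ {x} in both cases. Next, y ∈ {x, y} gives y = x or y = v, and symmetrically v
    = u or v = y; if neither yields y = v at once, then y = x = u = v. *)
Lemma pair_inj (G : list form) (p x y u v : nat) :
  G ⊢ is_pair p x y -> G ⊢ is_pair p u v -> G ⊢ (x ≐ u ∧ y ≐ v).
Proof.
  assert (L : forall G x y u v, G ⊢ is_pair p x y -> G ⊢ is_pair p u v -> G ⊢ (x ≐ u)).
  { clear; intros G x y u v H K.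
    fobtain s Hs from (single_exists G x).
    assert (S : G ⊢ (s ∈ p)) by apply (pair_iff _ H), prf_orI1, Hs.
    apply (pair_iff _ K) in S. felim_or S as S'.
    - apply eq_sym, (single_iff _ Hs), (single_iff _ S'), prf_eqI.
    - apply eq_sym, (single_iff _ Hs), (upair_iff _ S'), prf_orI1, prf_eqI. }
  intros H K; assert (E := L _ _ _ _ _ H K); apply prf_andI; [exact E|].
  assert (D : forall G x y u v, G ⊢ is_pair p x y -> G ⊢ is_pair p u v ->
     G ⊢ (y ≐ x ∨ y ≐ v)).
  { clear - L; intros G x y u v H K; assert (E := L _ _ _ _ _ H K).
    fobtain d Hd from (upair_exists G x y).
    assert (Y : G ⊢ (y ∈ d)) by apply (upair_iff _ Hd), prf_orI2, prf_eqI.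
    assert (S : G ⊢ (d ∈ p)) by apply (pair_iff _ H), prf_orI2, Hd.
    apply (pair_iff _ K) in S. felim_or S as S'.
    - apply prf_orI1, (eq_trans (y := u)); [apply (single_iff _ S'), Y | apply eq_sym, E].
    - apply (upair_iff _ S') in Y. felim_or Y as Y'.
      + apply prf_orI1, (eq_trans Y'), eq_sym, E.
      + apply prf_orI2, Y'. }
  assert (D1 := D _ _ _ _ _ H K).
  felim_or D1 as Y; [|exact Y].
  assert (D2 := D _ _ _ _ _ K H).
  felim_or D2 as V; [|apply eq_sym, V].
  apply (eq_trans Y), (eq_trans E), eq_sym, V.
Qed.

(** * Replacement and functions *)

Lemma subset_elim (G : list form) (x y : nat) :
  G ⊢ subset x y -> forall z, G ⊢ (z ∈ x) -> G ⊢ (z ∈ y).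
Proof. intros H z; exact (@ball_elim _ _ _ H z). Qed.

Definition functional (a : nat) (A : form) : form := ∀[a] ExUnique A.

(** This is the conclusion of [replacement] with its witness instantiated to [b]; hence the shift by
    2 where the axiom has 3. *)
Definition image (b a : nat) (A : form) : form :=
  ∀ (0 ∈ 1 + b ⇔ ∃[1 + a] ren (1 .: 0 .: (fun n => 2 + n)) A).

Lemma inst_app2 (A : form) (x y : nat) : inst y (ren (up (x .: (fun n => n))) A) = app2 A x y.
Proof.
  unfold inst, app2; rewrite ren_ren; apply ren_ext; intros [|[|n]]; reflexivity.
Qed.

(** Separates existence from uniqueness, which [ExUnique] states in one formula. The orientation
    [z ≐ y] is that of [ExUnique], where the competing value stands on the left. *)
Lemma functional_intro (G : list form) (a : nat) (A : form) :
  (forall x, (x ∈ a) :: G ⊢ (∃ ren (up (x .: (fun n => n))) A)) ->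
  (forall x y z, (x ∈ a) :: G ⊢ (app2 A x y ⇒ app2 A x z ⇒ z ≐ y)) ->
  G ⊢ functional a A.
Proof.
  intros E U; apply all_intro; intros x; apply imp_intro.
  apply (ex_elim (E x)); intros y; apply prf_exI with y, prf_andI; [apply hyp|].
  apply all_intro; intros z; apply imp_intro.
  match goal with |- ?B :: ?D :: _ ⊢ _ =>
    replace B with (app2 A x z) by
      ren_eq;
    replace D with (app2 A x y) by (symmetry; apply inst_app2)
  end.
  apply (imp_elim (A := app2 A x z)); [|apply hyp].
  apply weaken1, (imp_elim (A := app2 A x y)); [|apply hyp].
  apply weaken1, U.
Qed.

Lemma functional_exists (G : list form) (a : nat) (A : form) (x : nat) :
  G ⊢ functional a A -> G ⊢ (x ∈ a) -> G ⊢ (∃ ren (up (x .: (fun n => n))) A).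
Proof.
  intros F H; apply (ex_elim (ball_elim F H)); intros y.
  apply prf_exI with y, (proj1 (proj1 (and_iff _ _ _) (hyp _ _))).
Qed.

Lemma functional_unique (G : list form) (a : nat) (A : form) (x y z : nat) :
  G ⊢ functional a A -> G ⊢ (x ∈ a) -> G ⊢ app2 A x y -> G ⊢ app2 A x z ->
  G ⊢ (y ≐ z).
Proof.
  intros F H Hy Hz; apply (ex_elim (ball_elim F H)); intros w; fpush K.
  apply and_iff in K; destruct K as [_ K].
  assert (L : forall v, G ⊢ app2 A x v -> G ⊢ (v ≐ w)).
  { intros v Hv; apply (imp_elim (all_elim K v)).
    match goal with |- _ ⊢ ?B => replace B with (app2 A x v); [exact Hv|] end.
    unfold app2; rewrite !ren_ren; apply ren_ext; intros [|[|n]]; reflexivity. }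
  apply (eq_trans (y := w)); [|apply eq_sym]; apply L; assumption.
Qed.

(** The elimination form keeps a further shift of the arbitrary formula [A] under an existential
    quantifier out of the statement. *)
Lemma image_exists (G : list form) (a : nat) (A : form) (C : form) :
  G ⊢ functional a A -> (forall b, image b a A :: G ⊢ C) -> G ⊢ C.
Proof.
  intros F H.
  assert (E : G ⊢ replacement A a) by (apply prf_ax; left; constructor).
  apply (ex_elim (imp_elim E F)); intros b.
  replace (inst b _) with (image b a A); [apply H|].
  unfold image; ren_eq.
Qed.

Lemma image_iff (G : list form) (a b : nat) (A : form) (y : nat) :
  G ⊢ image b a A -> (G ⊢ (y ∈ b) <-> G ⊢ (∃[a] ren (1 + y .: 0 .: (fun n => 1 + n)) A)).
Proof.
  intros H.
  replace (∃[a] _) with (inst y (∃[1 + a] ren (1 .: 0 .: (fun n => 2 + n)) A)).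
  - exact (iff_elim (all_elim H y)).
  - unfold inst; rewrite ren_BEx, ren_ren; unfold BEx; cbn; do 2 f_equal.
    apply ren_ext; intros [|[|n]]; reflexivity.
Qed.

(* [f] is the set of pairs (x, y) with [x ∈ a] and [A(x, y)]. *)
Definition graph (f a : nat) (A : form) : form :=
  ∀ (0 ∈ 1 + f ⇔
     ∃[1 + a] ∃ (is_pair 2 1 0 ∧ ren (0 .: 1 .: (fun n => 3 + n)) A)).

(** Relates x to the pair (x, y), so that a graph becomes an image and replacement supplies it. *)
Definition graph_value (A : form) : form :=
  ∃ (is_pair 1 2 0 ∧ ren (0 .: 2 .: (fun n => 3 + n)) A).

(** Since [prf_eqE] substitutes for the variable 0 only, value and argument are exchanged in turn,
    each after a renaming of [A] that puts it at 0. *)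
Lemma app2_congr (G : list form) (A : form) (x y u v : nat) :
  G ⊢ (x ≐ u) -> G ⊢ (y ≐ v) -> G ⊢ app2 A u v -> G ⊢ app2 A x y.
Proof.
  intros Hx Hy H.
  apply eq_sym in Hx, Hy.
  replace (app2 A x y) with (inst y (ren (0 .: 1 + x .: (fun n => 1 + n)) A)) by ren_eq.
  apply (prf_eqE _ Hy).
  replace (inst v _) with (inst x (ren (1 + v .: 0 .: (fun n => 1 + n)) A)) by ren_eq.
  apply (prf_eqE _ Hx).
  replace (inst u _) with (app2 A u v) by ren_eq; exact H.
Qed.

Lemma graph_value_intro (G : list form) (A : form) (x y p : nat) :
  G ⊢ is_pair p x y -> G ⊢ app2 A x y -> G ⊢ app2 (graph_value A) x p.
Proof.
  intros Hp H; apply prf_exI with y.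
  apply prf_andI; [exact Hp|].
  match goal with |- _ ⊢ ?B => replace B with (app2 A x y) by ren_eq end; exact H.
Qed.

Lemma graph_value_elim (G : list form) (A C : form) (x p : nat) :
  G ⊢ app2 (graph_value A) x p ->
  (forall y, G ⊢ (is_pair p x y ⇒ app2 A x y ⇒ C)) -> G ⊢ C.
Proof.
  intros H HC; apply (ex_elim H); intros y.
  apply prf_impE with (app2 A x y); [apply prf_impE with (is_pair p x y)|].
  - apply weaken1, HC.
  - exact (proj1 (proj1 (and_iff _ _ _) (hyp _ _))).
  - replace (app2 A x y) with
      (inst y (ren (up (p .: x .: (fun n => n))) (ren (0 .: 2 .: (fun n => 3 + n)) A)))
      by ren_eq.
    exact (proj2 (proj1 (and_iff _ _ _) (hyp _ _))).
Qed.

(** The relation [graph_value A] inherits functionality from [A]: the value y is unique, and a pair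
    is determined by its components. *)
Lemma graph_exists (G : list form) (a : nat) (A C : form) :
  G ⊢ functional a A -> (forall f, graph f a A :: G ⊢ C) -> G ⊢ C.
Proof.
  intros F H; apply image_exists with a (graph_value A).
  - clear H; apply functional_intro.
    + intros x; fpush Hx; apply (ex_elim (functional_exists F Hx)); intros y.
      rewrite inst_app2; fpush Hy.
      apply (ex_elim (pair_exists G x y)); intros p; fsimp; fpush Hp.
      apply prf_exI with p; rewrite inst_app2; apply (graph_value_intro Hp Hy).
    + intros x p q; fpush Hx; fintros Hp Hq.
      apply (graph_value_elim Hp); intros y; fintros Py Hy.
      apply (graph_value_elim Hq); intros z; fintros Pz Hz.
      apply (ext_unique Pz); change (G ⊢ is_pair p x z);
      frw (functional_unique F Hx Hy Hz); exact Py.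
  - intros f.
    replace (image f a (graph_value A)) with (graph f a A); [apply H|].
    unfold image, graph, graph_value; ren_eq.
Qed.

Lemma maps_to_intro (G : list form) (f x y p : nat) :
  G ⊢ (p ∈ f) -> G ⊢ is_pair p x y -> G ⊢ maps_to f x y.
Proof. intros H K; apply (bex_intro H); exact K. Qed.

Lemma graph_mem (G : list form) (f a : nat) (A : form) (p : nat) :
  G ⊢ graph f a A ->
  (G ⊢ (p ∈ f) <->
   G ⊢ (∃[a] ∃ (is_pair (2 + p) 1 0 ∧ ren (0 .: 1 .: (fun n => 2 + n)) A))).
Proof.
  intros F.
  replace (∃[a] _) with (inst p (∃[1 + a] ∃ (is_pair 2 1 0 ∧
    ren (0 .: 1 .: (fun n => 3 + n)) A))) by ren_eq.
  exact (iff_elim (all_elim F p)).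
Qed.

Lemma graph_elim (G : list form) (f a : nat) (A C : form) (p : nat) :
  G ⊢ graph f a A -> G ⊢ (p ∈ f) ->
  (forall x y, G ⊢ (x ∈ a ⇒ is_pair p x y ⇒ app2 A x y ⇒ C)) -> G ⊢ C.
Proof.
  intros F H HC; apply (graph_mem _ F) in H.
  apply (ex_elim H); intros x.
  replace (inst x _) with
    (x ∈ a ∧ ∃ (is_pair (1 + p) (1 + x) 0 ∧ ren (0 .: 1 + x .: (fun n => 1 + n)) A))
    by ren_eq.
  apply (ex_elim (proj2 (proj1 (and_iff _ _ _) (hyp _ _)))); intros y.
  replace (inst y _) with (is_pair p x y ∧ app2 A x y) by ren_eq.
  apply imp_elim with (app2 A x y); [apply imp_elim with (is_pair p x y);
    [apply imp_elim with (x ∈ a)|]|].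
  - do 2 apply weaken1; apply HC.
  - apply weaken1; exact (proj1 (proj1 (and_iff _ _ _) (hyp _ _))).
  - exact (proj1 (proj1 (and_iff _ _ _) (hyp _ _))).
  - exact (proj2 (proj1 (and_iff _ _ _) (hyp _ _))).
Qed.

Lemma graph_intro (G : list form) (f a : nat) (A : form) (p x y : nat) :
  G ⊢ graph f a A -> G ⊢ (x ∈ a) -> G ⊢ is_pair p x y -> G ⊢ app2 A x y ->
  G ⊢ (p ∈ f).
Proof.
  intros F Hx Hp H; apply (graph_mem _ F), (bex_intro Hx), prf_exI with y.
  match goal with |- _ ⊢ ?B => replace B with (is_pair p x y ∧ app2 A x y) by ren_eq end.
  apply prf_andI; assumption.
Qed.

Lemma graph_iff (G : list form) (f a : nat) (A : form) (x y : nat) :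
  G ⊢ graph f a A ->
  (G ⊢ maps_to f x y <-> G ⊢ (x ∈ a) /\ G ⊢ app2 A x y).
Proof.
  intros F; rewrite <- and_iff; split.
  - intros H; fobtain p Hp Hxy from H.
    apply (graph_elim F Hp); intros u v; fintros Hu Huv Huv'.
    destruct (proj1 (and_iff _ _ _) (pair_inj Hxy Huv)) as [Ex Ey].
    apply prf_andI; [frwl Ex; exact Hu | apply (app2_congr Ex Ey Huv')].
  - intros H; apply and_iff in H; destruct H as [Hx H].
    fobtain p Hp from (pair_exists G x y).
    apply (maps_to_intro (p := p)); [|exact Hp].
    apply (graph_intro F Hx Hp H).
Qed.

Lemma graph_is_map (G : list form) (f a b : nat) (A : form) :
  G ⊢ functional a A -> G ⊢ graph f a A ->
  (forall x y, G ⊢ (x ∈ a ⇒ app2 A x y ⇒ y ∈ b)) -> G ⊢ is_map f a b.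
Proof.
  intros F Hf Hb; apply prf_andI.
  - apply all_intro; intros p; apply imp_intro.
    apply (graph_elim (weaken1 _ Hf) (hyp _ _)); intros x y.
    apply weaken1 with (B := p ∈ f) in Hf, F; specialize (Hb x y).
    apply weaken1 with (B := p ∈ f) in Hb.
    change (inst p (0 ∈ 1 + f) :: G) with ((p ∈ f) :: G).
    set (G' := _ :: G) in *; clearbody G'; clear G; rename G' into G.
    fintros Hx Hp Hy.
    apply (bex_intro (x := x)); [exact Hx|fsimp].
    apply (bex_intro (x := y)); [|exact Hp].
    exact (imp_elim (imp_elim Hb Hx) Hy).
  - clear Hb; apply functional_intro.
    + intros x; fpush Hx. apply (ex_elim (functional_exists F Hx)); intros y.
      rewrite inst_app2; fpush Hy.
      fexists y. apply (graph_iff _ _ Hf); split; assumption.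
    + intros x y z; fpush Hx; unfold app2; fsimp; fintros Hy Hz.
      apply (graph_iff _ _ Hf) in Hy, Hz.
      apply (functional_unique F Hx); [apply Hz | apply Hy].
Qed.

Lemma map_value (G : list form) (f a b x : nat) :
  G ⊢ is_map f a b -> G ⊢ (x ∈ a) -> G ⊢ (∃ maps_to (1 + f) (1 + x) 0).
Proof. intros F; apply and_iff in F; apply (functional_exists (proj2 F)). Qed.

Lemma map_unique (G : list form) (f a b x y z : nat) :
  G ⊢ is_map f a b -> G ⊢ (x ∈ a) -> G ⊢ maps_to f x y -> G ⊢ maps_to f x z ->
  G ⊢ (y ≐ z).
Proof.
  intros F; apply and_iff in F.
  exact (functional_unique (A := maps_to (2 + f) 1 0) (proj2 F)).
Qed.

Lemma map_cod (G : list form) (f a b x y : nat) :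
  G ⊢ is_map f a b -> G ⊢ maps_to f x y -> G ⊢ (y ∈ b).
Proof.
  intros F H; apply and_iff, proj1 in F.
  fobtain p Hp Hxy from H.
  fobtain u Hu K from (ball_elim F Hp).
  fobtain v Hv Hp' from K.
  destruct (proj1 (and_iff _ _ _) (pair_inj Hxy Hp')) as [_ E].
  frwl E; exact Hv.
Qed.

(** * Power sets *)

Lemma single_functional (G : list form) (u : nat) : G ⊢ functional u (is_single 0 1).
Proof.
  apply functional_intro.
  - intros x; apply weaken1; fsimp; apply single_exists.
  - intros x y z; unfold app2; fsimp; apply weaken1; fintros Hy Hz.
    apply (ext_unique Hz Hy).
Qed.

Lemma powerset_P1_complete (G : list form) (u v : nat) :
  G ⊢ (∀ (0 ∈ 1 + v ⇔ subset 0 (1 + u))) -> G ⊢ P1_complete v.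
Proof.
  intros V; fintros s H; apply and_iff, proj1 in H.
  fobtain w Hw from (union_exists G s).
  apply (bex_intro (x := w)); [|exact Hw].
  apply (iff_elim (all_elim V w)); fsimp; fintros x Hx.
  apply (union_iff _ Hw) in Hx; fobtain t Ht K from Hx.
  assert (Hv := subset_elim H Ht).
  apply (iff_elim (all_elim V t)) in Hv; exact (subset_elim Hv K).
Qed.

Lemma powerset_embeds (G : list form) (u v : nat) :
  G ⊢ (∀ (0 ∈ 1 + v ⇔ subset 0 (1 + u))) -> G ⊢ strongly_embedded u v.
Proof.
  intros V; assert (F := single_functional G u).
  apply (graph_exists F); intros f; fpush Hf.
  fexists f; apply prf_andI; [|apply prf_andI].
  - apply (graph_is_map F Hf); intros x y; unfold app2; fsimp; fintros Hx Hy.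
    apply (iff_elim (all_elim V y)); fsimp; fintros z Hz.
    apply (single_iff _ Hy) in Hz; frwl Hz; exact Hx.
  - fintros x y z H; apply and_iff in H; destruct H as [Hx Hy].
    apply (graph_iff _ _ Hf) in Hx, Hy; destruct Hx as [_ Hx], Hy as [_ Hy].
    apply (single_iff _ Hy), (single_iff _ Hx), prf_eqI.
  - fintros x Hx y Hy; apply (graph_iff _ _ Hf) in Hy.
    fexists x; apply Hy.
Qed.

Lemma power_set_injectives (G : list form) :
  G ⊢ power_set -> G ⊢ strongly_enough_injectives.
Proof.
  intros P; fintros u; fobtain v Hv from (all_elim P u).
  fexists v; apply prf_andI.
  - apply (powerset_P1_complete Hv).
  - apply (powerset_embeds Hv).
Qed.

(** * The chain from (1) to (8) *)

Lemma injectives_inhabited (G : list form) :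
  G ⊢ strongly_enough_injectives -> G ⊢ every_inhabited_embeds.
Proof. intros P; fintros u H; exact (all_elim P u). Qed.

Lemma singleton_inhabited (G : list form) (x : nat) :
  G ⊢ singleton x -> G ⊢ inhabited x.
Proof.
  intros H; fobtain y Hy from H; fexists y; apply (single_iff _ Hy), prf_eqI.
Qed.

Lemma inhabited_singleton_embeds (G : list form) :
  G ⊢ every_inhabited_embeds -> G ⊢ every_singleton_embeds.
Proof.
  intros P; fintros u H; apply (imp_elim (all_elim P u)), singleton_inhabited, H.
Qed.

(** The empty set is found as an element of the inductive set given by strong infinity. *)
Lemma empty_exists (G : list form) : G ⊢ (∃ is_empty 0).
Proof.
  assert (N : G ⊢ strong_infinity) by (apply prf_ax; left; constructor).
  fobtain n Hn from N; apply and_iff, proj1 in Hn; apply and_iff, proj1 in Hn.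
  fobtain z Hz K from Hn; fexists z; exact K.
Qed.

Lemma singleton_one_embeds (G : list form) :
  G ⊢ every_singleton_embeds -> G ⊢ one_embeds.
Proof.
  intros P; fobtain z Hz from (empty_exists G).
  fobtain o Ho from (single_exists G z).
  fexists o; apply prf_andI.
  - fexists z; apply prf_andI; assumption.
  - apply (imp_elim (all_elim P o)); fexists z; exact Ho.
Qed.

Lemma one_singleton_embeds (G : list form) :
  G ⊢ one_embeds -> G ⊢ some_singleton_embeds.
Proof.
  intros P; fobtain o Ho H from P; fexists o; apply prf_andI; [|exact H].
  fobtain z K Hz from Ho; fexists z; exact Hz.
Qed.

Lemma some_singleton_inhabited_embeds (G : list form) :
  G ⊢ some_singleton_embeds -> G ⊢ some_inhabited_embeds.
Proof.
  intros P; fobtain u Hu H from P; fexists u; apply prf_andI; [|exact H].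
  apply singleton_inhabited, Hu.
Qed.

(** A strong embedding sends any element of its domain to a singleton, and this value is an element
    of the complete codomain. *)
Lemma inhabited_embeds_singleton (G : list form) :
  G ⊢ some_inhabited_embeds -> G ⊢ P1_complete_with_singleton.
Proof.
  intros P; fobtain u Hu H from P; fobtain x Hx from Hu.
  fobtain v Hv K from H; fobtain i Hi from K; fexists v; apply prf_andI; [exact Hv|].
  apply and_iff in Hi; destruct Hi as [Hi Hs]; apply and_iff, proj2 in Hs.
  fobtain y Hy from (map_value Hi Hx).
  apply (bex_intro (x := y)); [apply (map_cod Hi Hy)|].
  apply (imp_elim (all_elim (ball_elim Hs Hx) y)); exact Hy.
Qed.

Lemma complete_singleton_inhabited (G : list form) :
  G ⊢ P1_complete_with_singleton -> G ⊢ P1_complete_with_inhabited.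
Proof.
  intros P; fobtain e He H from P; fobtain c Hc K from H.
  fexists e; apply prf_andI; [exact He|].
  apply (bex_intro Hc), singleton_inhabited, K.
Qed.

(** * Power sets from (8) and exponentiation *)

Lemma separation_exists (G : list form) (A : form) (a : nat) :
  delta0 A -> G ⊢ separation A a.
Proof. intros H; apply prf_ax; left; constructor; exact H. Qed.

(* {x ∈ {b} | u ∈ v} *)
Lemma truth_value_exists (G : list form) (b u v : nat) :
  G ⊢ (∃ ∀ (0 ∈ 1 ⇔ 0 ≐ 2 + b ∧ 2 + u ∈ 2 + v)).
Proof.
  fobtain d Hd from (single_exists G b).
  fobtain s Hs from (separation_exists G d (delta0_mem (1 + u) (1 + v))).
  fexists s; fintros x; fiff Hx.
  - apply (iff_elim (all_elim Hs x)) in Hx; fsimp_in Hx.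
    apply and_iff in Hx; rewrite (single_iff x Hd) in Hx; apply and_iff, Hx.
  - apply (iff_elim (all_elim Hs x)); fsimp.
    apply and_iff; rewrite (single_iff x Hd); apply and_iff, Hx.
Qed.

(* A subset [t] of [{a}] is cut out of the union [u] of [{x ∈ {c} | a ∈ t}],
   which belongs to [e], since [a ∈ c] makes [a ∈ u] equivalent to [a ∈ t]. *)
Lemma single_powerset_exists (G : list form) (e c a : nat) :
  G ⊢ P1_complete e -> G ⊢ (c ∈ e) -> G ⊢ (a ∈ c) ->
  G ⊢ (∃ ∀ (0 ∈ 1 ⇔ ∀[0] 0 ≐ 3 + a)).
Proof.
  intros E Hc Ha.
  apply image_exists with e (∀ (0 ∈ 1 ⇔ 0 ∈ 2 ∧ 0 ≐ 3 + a)).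
  - apply functional_intro.
    + intros y; apply weaken1; fsimp.
      exact (separation_exists G y (delta0_eq 0 (1 + a))).
    + intros y s t; unfold app2; fsimp; apply weaken1; fintros Hs Ht.
      apply (ext_unique Ht Hs).
  - intros q; fpush Hq; fexists q; fintros t; fiff H.
    + apply (image_iff _ Hq) in H; fobtain y Hy Ht from H; fintros x Hx.
      apply (iff_elim (all_elim Ht x)) in Hx; fsimp_in Hx;
      apply and_iff in Hx; apply Hx.
    + fobtain s Hs from (truth_value_exists G c a t).
      (* Stated for every context, because [fpush] carries derivations into an extended context, but
         not equivalences between them. *)
      assert (Hs' : forall G x,
        G ⊢ (∀ (0 ∈ 1 + s ⇔ 0 ≐ 1 + c ∧ 1 + a ∈ 1 + t)) ->
        G ⊢ (x ∈ s) <-> G ⊢ (x ≐ c) /\ G ⊢ (a ∈ t)).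
      { intros G' x K; rewrite <- and_iff; exact (iff_elim (all_elim K x)). }
      assert (U : G ⊢ (∃[e] is_union 0 (1 + s))).
      { apply (imp_elim (all_elim E s)), prf_andI.
        - fsimp; fintros x Hx; apply Hs' in Hx; auto; destruct Hx as [Hx _].
          frwl Hx; exact Hc.
        - fexists c; fintros x Hx; apply Hs' in Hx; auto; apply Hx. }
      fobtain u Hu Hus from U.
      apply (image_iff _ Hq), (bex_intro Hu); fsimp; fintros x; fiff Hx.
      * assert (Ex := ball_elim H Hx); fsimp_in Ex.
        apply prf_andI; [|exact Ex].
        apply (union_iff _ Hus), (bex_intro (x := c)); fsimp.
        -- apply Hs'; auto; split; [apply prf_eqI | frw Ex; exact Hx].
        -- frwl Ex; exact Ha.
      * apply and_iff in Hx; destruct Hx as [Hx Ex].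
        apply (union_iff _ Hus) in Hx; fobtain v Hv K from Hx.
        apply Hs' in Hv; auto; destruct Hv as [_ Hv]; frwl Ex; exact Hv.
Qed.

(* {w ∈ z | a ∈ f(w)} is the union over [w ∈ z] of {v ∈ {w} | a ∈ f(w)}: the
   formula [maps_to] is not Δ₀, so separation does not apply directly. *)
Lemma preimage_exists (G : list form) (f z q a : nat) :
  G ⊢ is_map f z q ->
  G ⊢ (∃ ∀ (0 ∈ 1 ⇔ 0 ∈ 2 + z ∧ ∃ (maps_to (3 + f) 1 0 ∧ 3 + a ∈ 0))).
Proof.
  intros F.
  apply image_exists with z (∀ (0 ∈ 1 ⇔ 0 ≐ 2 ∧ ∃ (maps_to (4 + f) 3 0 ∧ 4 + a ∈ 0))).
  - apply functional_intro.
    + intros w; fpush Hw; fsimp.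
      (* Once the value [y] of [f] at [w] is at hand, the condition becomes the Δ₀ formula a ∈ y,
         and separation yields the set. *)
      fobtain y Hy from (map_value F Hw).
      fobtain s Hs from (truth_value_exists G w a y).
      fexists s; fintros v; fiff Hv.
      * apply (iff_elim (all_elim Hs v)) in Hv; fsimp_in Hv.
        apply and_iff in Hv; destruct Hv as [E Hv]; apply prf_andI; [exact E|].
        fexists y; apply prf_andI; assumption.
      * apply (iff_elim (all_elim Hs v)); fsimp.
        apply and_iff in Hv; destruct Hv as [E Hv]; apply prf_andI; [exact E|].
        fobtain x Hx K from Hv.
        assert (D := map_unique F Hw Hx Hy); frw D; exact K.
    + intros w s t; unfold app2; fsimp; apply weaken1; fintros Hs Ht.
      apply (ext_unique Ht Hs).
  - intros b; fpush Hb.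
    fobtain u Hu from (union_exists G b).
    fexists u; fintros v; fiff Hv.
    + apply (union_iff _ Hu) in Hv; fobtain s Hs K from Hv.
      apply (image_iff _ Hb) in Hs; fobtain w Hw Hs' from Hs.
      apply (iff_elim (all_elim Hs' v)) in K; fsimp_in K.
      apply and_iff in K; destruct K as [E K]; apply prf_andI.
      * frwl E; exact Hw.
      * fobtain y Hy Ka from K; fexists y; apply prf_andI; [frwl E; exact Hy|exact Ka].
    + apply and_iff in Hv; destruct Hv as [Hv K].
      fobtain y Hy Ka from K.
      fobtain s Hs from (truth_value_exists G v a y).
      apply (union_iff _ Hu), (bex_intro (x := s)); fsimp.
      * apply (image_iff _ Hb), (bex_intro Hv); fsimp; fintros x; fiff Hx.
        -- apply (iff_elim (all_elim Hs x)) in Hx; fsimp_in Hx.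
           apply and_iff in Hx; destruct Hx as [E Hx]; apply prf_andI; [exact E|].
           fexists y; apply prf_andI; assumption.
        -- apply (iff_elim (all_elim Hs x)); fsimp.
           apply and_iff in Hx; destruct Hx as [E Hx]; apply prf_andI; assumption.
      * apply (iff_elim (all_elim Hs v)); fsimp.
        apply prf_andI; [apply prf_eqI | exact Ka].
Qed.

Lemma inhabited_power_set (G : list form) :
  G ⊢ P1_complete_with_inhabited -> G ⊢ power_set.
Proof.
  intros P; fobtain e He H from P; fobtain c Hc K from H; fobtain a Ha from K.
  fobtain q Hq from (single_powerset_exists He Hc Ha).
  fintros z.
  assert (X : G ⊢ exponentiation) by (apply prf_ax; right; reflexivity).
  (* The outer quantifier of [exponentiation] is the domain, so [m] is the set of maps from [z] to
     [q], where [q] is the power set of {a}. *)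
  fobtain m Hm from (all_elim (all_elim X z) q).
  apply image_exists with m (∀ (0 ∈ 1 ⇔ 0 ∈ 3 + z ∧ ∃ (maps_to 3 1 0 ∧ 4 + a ∈ 0))).
  - apply functional_intro.
    + intros f; fpush Hf; fsimp.
      apply (iff_elim (all_elim Hm f)) in Hf.
      exact (preimage_exists a Hf).
    + intros f s t; unfold app2; fsimp; apply weaken1; fintros Hs Ht.
      apply (ext_unique Ht Hs).
  - intros p; fpush Hp; fexists p; fintros t; fiff Ht.
    + apply (image_iff _ Hp) in Ht; fobtain f Hf K' from Ht; fintros w Hw.
      apply (iff_elim (all_elim K' w)) in Hw; fsimp_in Hw.
      apply and_iff in Hw; apply Hw.
    + assert (F : G ⊢ functional z (∀ (0 ∈ 1 ⇔ 0 ≐ 3 + a ∧ 2 ∈ 3 + t))).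
      { apply functional_intro.
        - intros w; apply weaken1; fsimp; exact (truth_value_exists G a w t).
        - intros w s u; unfold app2; fsimp; apply weaken1; fintros Hs Hu.
          apply (ext_unique Hu Hs). }
      apply (graph_exists F); intros f; fpush Hf.
      apply (image_iff _ Hp), (bex_intro (x := f)).
      * apply (iff_elim (all_elim Hm f)), (graph_is_map F Hf).
        intros w y; unfold app2; fsimp; fintros Hw Hy.
        apply (iff_elim (all_elim Hq y)); fsimp; fintros x Hx.
        apply (iff_elim (all_elim Hy x)) in Hx; fsimp_in Hx.
        apply and_iff in Hx; apply Hx.
      * fsimp; fintros w; fiff Hw.
        -- assert (Hz := subset_elim Ht Hw); apply prf_andI; [exact Hz|].
           apply (ex_elim (functional_exists F Hz)); intros y.
           rewrite inst_app2; fpush Hy; fexists y; apply prf_andI.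
           ++ apply (graph_iff _ _ Hf); split; assumption.
           ++ apply (iff_elim (all_elim Hy a)); fsimp.
              apply prf_andI; [apply prf_eqI | exact Hw].
        -- apply and_iff in Hw; destruct Hw as [_ Hw]; fobtain y Hy Ka from Hw.
           apply (graph_iff _ _ Hf) in Hy; destruct Hy as [_ Hy].
           apply (iff_elim (all_elim Hy a)) in Ka; fsimp_in Ka.
           apply and_iff in Ka; apply Ka.
Qed.

(** * The equivalences *)

Lemma provable_iff (A B : form) :
  (forall G, G ⊢ A -> G ⊢ B) -> (forall G, G ⊢ B -> G ⊢ A) ->
  provable CZF0_exp (A ⇔ B).
Proof. intros H K; apply iff_intro; [apply H|apply K]; apply hyp. Qed.

Theorem theorem21 :
  provable CZF0_exp (Iff strongly_enough_injectives power_set) /\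
  provable CZF0_exp (Iff every_inhabited_embeds power_set) /\
  provable CZF0_exp (Iff every_singleton_embeds power_set) /\
  provable CZF0_exp (Iff one_embeds power_set) /\
  provable CZF0_exp (Iff some_singleton_embeds power_set) /\
  provable CZF0_exp (Iff some_inhabited_embeds power_set) /\
  provable CZF0_exp (Iff P1_complete_with_singleton power_set) /\
  provable CZF0_exp (Iff P1_complete_with_inhabited power_set).
Proof.
  pose proof power_set_injectives. pose proof injectives_inhabited.
  pose proof inhabited_singleton_embeds. pose proof singleton_one_embeds.
  pose proof one_singleton_embeds. pose proof some_singleton_inhabited_embeds.
  pose proof inhabited_embeds_singleton. pose proof complete_singleton_inhabited.
  pose proof inhabited_power_set.
  (* Both directions follow the cycle of implications; the longest paths have eight links, within
     the search depth 10. *)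
  repeat split; apply provable_iff; auto 10.
Qed.
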